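(* Let $\mathsf{K}$ be any one of the following four classes of logics (the levels of the Frege hierarchy): selfextensional logics; fully selfextensional logics; Fregean logics; fully Fregean logics. Then the problem of determining, given a finite consistent Hilbert calculus in a finite language, whether the logic it determines belongs to $\mathsf{K}$ is undecidable. Moreover, the problem remains undecidable when the inputs are restricted to finite consistent Hilbert calculi (in a finite language) that determine a finitely algebraizable logic; that is, there is no algorithm which, given any such calculus as input, decides whether its logic belongs to $\mathsf{K}$.
   Context: Logics. Fix an algebraic language and a countably infinite set $Var$ of variables. $Fm$ is the set of formulas (terms) over $Var$, and $\boldsymbol{Fm}$ the absolutely free algebra of formulas; substitutions are endomorphisms of $\boldsymbol{Fm}$. A logic $\mathcal{L}$ is a closure operator $C_{\mathcal{L}}$ on $Fm$ with $\sigma C_{\mathcal{L}}(\Gamma)\subseteq C_{\mathcal{L}}(\sigma\Gamma)$ for all substitutions $\sigma$ and $\Gamma \subseteq Fm$; write $\Gamma\vdash_{\mathcal{L}}\varphi$ for $\varphi\in C_{\mathcal{L}}(\Gamma)$. Write $\varphi\dashv\vdash_{\mathcal{L}}\psi$ if $\varphi\vdash_{\mathcal{L}}\psi$ and $\psi\vdash_{\mathcal{L}}\varphi$, and $\Gamma,\varphi\dashv\vdash_{\mathcal{L}}\psi,\Gamma$ if $\Gamma,\varphi\vdash_{\mathcal{L}}\psi$ and $\Gamma,\psi\vdash_{\mathcal{L}}\varphi$. $\mathcal{L}$ is consistent if $\emptyset\nvdash_{\mathcal{L}}\varphi$ for some formula $\varphi$. A rule is an expression $\Gamma\vdash\varphi$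 with $\Gamma\cup\{\varphi\}$ a finite set of formulas; a Hilbert calculus is a set of rules. The logic determined by a Hilbert calculus is given by: $\Gamma\vdash\varphi$ iff there is a finite proof of $\varphi$ from $\Gamma$ using substitution instances of the rules (equivalently, it is the least logic satisfying the rules). A Hilbert calculus is consistent if its logic is. Filters and congruences. For an algebra $\boldsymbol{A}$ and $F\subseteq A$, the Leibniz congruence $\boldsymbol{\Omega}^{\boldsymbol{A}}F$ is the largest congruence $\theta$ of $\boldsymbol{A}$ compatible with $F$ (i.e. $\langle a,b\rangle\in\theta$ and $a\in F$ imply $b\in F$). $F\subseteq A$ is a deductive filter of $\mathcal{L}$ on $\boldsymbol{A}$ if whenever $\Gamma\vdash_{\mathcal{L}}\varphi$ and $h\colon\boldsymbol{Fm}\to\boldsymbol{A}$ is a homomorphism with $h[\Gamma]\subseteq F$, then $h(\varphi)\in F$. $\mathcal{F}i_{\mathcal{L}}\boldsymbol{A}$ is the set of deductive filters (a closure system) and $Fi_{\mathcal{L}}^{\boldsymbol{A}}(\cdot)$ the associated closure operator. The Suszko congruence of $F \subseteq A$ is $\widetilde{\boldsymbol{\Omega}}^{\boldsymbol{A}}_{\mathcal{L}}F=\bigcap\{\boldsymbol{\Omega}^{\boldsymbol{A}}G: G\in\mathcal{F}i_{\mathcal{L}}\boldsymbol{A},\ F\subseteq G\}$. $\mathsf{Alg}\,\mathcal{L}$ is the class of algebras $\boldsymbol{A}$ for which there is $F\in\mathcal{F}i_{\mathcal{L}}\boldsymbol{A}$ with $\widetilde{\boldsymbol{\Omega}}^{\boldsymbol{A}}_{\mathcal{L}}F=\mathrm{Id}_{\boldsymbol{A}}$.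 $\mathsf{Mod}^{*}\mathcal{L}$ is the class of matrices $\langle\boldsymbol{A},F\rangle$ with $F\in\mathcal{F}i_{\mathcal{L}}\boldsymbol{A}$ and $\boldsymbol{\Omega}^{\boldsymbol{A}}F=\mathrm{Id}_{\boldsymbol{A}}$. Frege hierarchy. $\mathcal{L}$ is selfextensional if $\dashv\vdash_{\mathcal{L}}$ is a congruence on $\boldsymbol{Fm}$. $\mathcal{L}$ is fully selfextensional if for all $\boldsymbol{A}\in\mathsf{Alg}\,\mathcal{L}$ and $a,b\in A$: $Fi_{\mathcal{L}}^{\boldsymbol{A}}\{a\}=Fi_{\mathcal{L}}^{\boldsymbol{A}}\{b\}$ implies $a=b$. $\mathcal{L}$ is Fregean if for every $n$-ary function symbol $\lambda$ and $\Gamma\cup\{\alpha_1,\dots,\alpha_n,\beta_1,\dots,\beta_n\}\subseteq Fm$: if $\Gamma,\alpha_i\dashv\vdash_{\mathcal{L}}\beta_i,\Gamma$ for all $i\leq n$, then $\Gamma,\lambda(\alpha_1,\dots,\alpha_n)\dashv\vdash_{\mathcal{L}}\lambda(\beta_1,\dots,\beta_n),\Gamma$. $\mathcal{L}$ is fully Fregean if for all $\boldsymbol{A}\in\mathsf{Alg}\,\mathcal{L}$, $F\in\mathcal{F}i_{\mathcal{L}}\boldsymbol{A}$ and $a,b\in A$: $Fi_{\mathcal{L}}^{\boldsymbol{A}}(F\cup\{a\})=Fi_{\mathcal{L}}^{\boldsymbol{A}}(F\cup\{b\})$ implies $\langle a,b\rangle\in\widetilde{\boldsymbol{\Omega}}^{\boldsymbol{A}}_{\mathcal{L}}F$.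 Finite algebraizability. $\mathcal{L}$ is finitely algebraizable if (a) there is a finite set of formulas $\rho(x,y)$ such that for every algebra $\boldsymbol{A}$, $F\in\mathcal{F}i_{\mathcal{L}}\boldsymbol{A}$ and $a,b\in A$: $\langle a,b\rangle\in\boldsymbol{\Omega}^{\boldsymbol{A}}F$ iff $\rho^{\boldsymbol{A}}(a,b)\subseteq F$; and (b) there is a set $\tau(x)$ of equations in the single variable $x$ such that $F=\{a\in A:\boldsymbol{A}\vDash\tau(a)\}$ for all $\langle\boldsymbol{A},F\rangle\in\mathsf{Mod}^{*}\mathcal{L}$. *)

(* Defs.v *)
From mathcomp Require Import all_boot.
From mathcomp Require Import boolp classical_sets.
From Stdlib Require List.

Set Implicit Arguments.
Unset Strict Implicit.
Unset Printing Implicit Defensive.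

Local Open Scope classical_set_scope.

Record language : Type := Language {
  symbol : Type;
  arity : symbol -> nat }.

(* The countably infinite set of variables is [nat]. *)
Inductive form (L : language) : Type :=
| Var (x : nat)
| App (f : symbol L) (args : 'I_(arity f) -> form L).

Arguments Var {L} x.
Arguments App {L} f args.

Record algebra (L : language) : Type := Algebra {
  carrier :> Type;
  op : forall f : symbol L, ('I_(arity f) -> carrier) -> carrier;
  carrier_inhabited : inhabited carrier }.

Arguments op {L} a f args.

Definition Fm (L : language) : algebra L :=
  Algebra (@App L) (inhabits (Var 0)).

Definition is_hom (L : language) (A B : algebra L) (h : A -> B) : Prop :=
  forall (f : symbol L) (a : 'I_(arity f) -> A),
    h (op A f a) = op B f (fun i => h (a i)).

Definition substitution (L : language) (s : form L -> form L) : Prop :=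
  @is_hom L (Fm L) (Fm L) s.

(* The value of a formula at an assignment of the variables, i.e. the value
   of the unique homomorphism from [Fm L] extending the assignment. *)
Fixpoint feval (L : language) (A : algebra L) (v : nat -> A) (t : form L) : A :=
  match t with
  | Var x => v x
  | App f args => op A f (fun i => feval v (args i))
  end.

Fixpoint vars (L : language) (t : form L) : set nat :=
  match t with
  | Var x => [set x]
  | App f args => \bigcup_i vars (args i)
  end.

Record congruence (L : language) (A : algebra L) (R : A -> A -> Prop) : Prop :=
  Congruence {
    congr_refl : forall a, R a a;
    congr_sym : forall a b, R a b -> R b a;
    congr_trans : forall a b c, R a b -> R b c -> R a c;
    congr_op : forall (f : symbol L) (a b : 'I_(arity f) -> A),
      (forall i, R (a i) (b i)) -> R (op A f a) (op A f b) }.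

Record logic (L : language) : Type := Logic {
  Cn : set (form L) -> set (form L);
  Cn_ext : forall G, G `<=` Cn G;
  Cn_mono : forall G D, G `<=` D -> Cn G `<=` Cn D;
  Cn_idem : forall G, Cn (Cn G) `<=` Cn G;
  Cn_struct : forall s G, substitution s -> s @` Cn G `<=` Cn (s @` G) }.

Definition consistent (L : language) (l : logic L) : Prop :=
  exists t : form L, ~ Cn l set0 t.

(* [Stdlib.Lists.List.In] rather than [\in]: [form L] carries no [eqType]
   structure. *)
Definition elems (T : Type) (s : seq T) : set T := [set x | List.In x s].

Record rule (L : language) : Type := Rule {
  premises : seq (form L);
  conclusion : form L }.

Inductive derives (L : language) (H : set (rule L)) (G : set (form L)) :
    form L -> Prop :=
| derives_hyp t : G t -> derives H G t
| derives_rule (r : rule L) (s : form L -> form L) :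
    H r -> substitution s ->
    (forall t, elems (premises r) t -> derives H G (s t)) ->
    derives H G (s (conclusion r)).

Section HilbertLogic.
Variables (L : language) (H : set (rule L)).

Lemma derives_cut G D : G `<=` derives H D -> derives H G `<=` derives H D.
Proof.
move=> GD t; elim=> {t} [t /GD //|r s Hr Hs _ IH].
exact: derives_rule.
Qed.

Lemma derives_mono G D : G `<=` D -> derives H G `<=` derives H D.
Proof. by move=> GD; apply: derives_cut => t /GD; apply: derives_hyp. Qed.

Lemma derives_struct s G :
  substitution s -> s @` derives H G `<=` derives H (s @` G).
Proof.
move=> Hs _ [t Ht <-]; elim: Ht => {t} [t Gt|r s' Hr Hs' _ IH].
  by apply: derives_hyp; exists t.
apply: (derives_rule (s := s \o s')) => // f a.
by rewrite /= Hs' Hs.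
Qed.

Definition hilbert_logic : logic L :=
  Logic (fun G t => @derives_hyp L H G t) derives_mono
    (fun G => @derives_cut (derives H G) G (fun t => id)) derives_struct.

End HilbertLogic.

Section Filters.
Variables (L : language) (A : algebra L).

Definition compatible (R : A -> A -> Prop) (F : set A) : Prop :=
  forall a b, R a b -> F a -> F b.

(* The union of all congruences compatible with [F]; [leibniz_largest] below
   shows that it is the largest of them. *)
Definition leibniz (F : set A) (a b : A) : Prop :=
  exists R, [/\ congruence R, compatible R F & R a b].

Definition is_filter (l : logic L) (F : set A) : Prop :=
  forall (G : set (form L)) (t : form L) (h : form L -> A),
    Cn l G t -> @is_hom L (Fm L) A h -> h @` G `<=` F -> F (h t).

Definition Fi (l : logic L) (X : set A) : set A := smallest (is_filter l) X.

Lemma Fi_filter l X : is_filter l (Fi l X).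
Proof.
move=> G t h Gt hh hG F [FF XF]; apply: (FF G) => // _ [u Gu <-].
by apply: (hG (h u)); [exists u | split].
Qed.

Definition suszko (l : logic L) (F : set A) (a b : A) : Prop :=
  forall G : set A, is_filter l G -> F `<=` G -> leibniz G a b.

Definition is_identity (R : A -> A -> Prop) : Prop :=
  forall a b, R a b <-> a = b.

Inductive unary_polynomial : (A -> A) -> Prop :=
| unary_id : unary_polynomial id
| unary_op p (f : symbol L) (i : 'I_(arity f)) (c : 'I_(arity f) -> A) :
    unary_polynomial p ->
    unary_polynomial (fun x => p (op A f (fun j => if j == i then x else c j))).

Definition poly_equiv (F : set A) (a b : A) : Prop :=
  forall p, unary_polynomial p -> (F (p a) <-> F (p b)).

Lemma poly_equiv_congruence F : congruence (poly_equiv F).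
Proof.
split=> // [x y Rxy p /Rxy [] //|x y z Rxy Ryz p pp|f x y Rxy p pp].
  exact: iff_trans (Rxy p pp) (Ryz p pp).
pose c k (j : 'I_(arity f)) := if (j < k)%N then y j else x j.
have cS k : (k <= arity f)%N -> F (p (op A f x)) <-> F (p (op A f (c k))).
  elim: k => [_|k IH kf]; first by rewrite (_ : c 0%N = x) //; apply: funext.
  rewrite IH 1?ltnW //; pose i := Ordinal kf.
  have := Rxy i _ (unary_op i (c k) pp).
  have -> : (fun j => if j == i then x i else c k j) = c k.
    by apply: funext => j; case: eqP => // ->; rewrite /c ltnn.
  suff -> : (fun j => if j == i then y i else c k j) = c k.+1 by [].
  apply: funext => j; rewrite /c ltnS.
  case: eqP => [->|/eqP ji]; first by rewrite leqnn.
  by rewrite [in RHS]leq_eqVlt (negPf (_ : j != k :> nat)).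
suff <- : c (arity f) = y by exact: cS.
by apply: funext => j; rewrite /c ltn_ord.
Qed.

Lemma leibniz_poly F a b : leibniz F a b <-> poly_equiv F a b.
Proof.
split=> [[R [cR FR Rab]] p pp|Hab].
  suff: R (p a) (p b).
    by move=> Rp; split; apply: FR => //; apply: congr_sym Rp.
  elim: pp a b Rab => [//|{}p f i c _ IH a b Rab]; apply: IH.
  by apply: (congr_op cR) => j; case: eqP => // _; apply: congr_refl.
exists (poly_equiv F); split=> //; first exact: poly_equiv_congruence.
by move=> x y /(_ _ unary_id) [].
Qed.

Lemma leibniz_largest F :
  [/\ congruence (leibniz F), compatible (leibniz F) F &
      forall R, congruence R -> compatible R F ->
        forall a b, R a b -> leibniz F a b].
Proof.
split; last by move=> R cR FR a b Rab; exists R.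
- suff -> : leibniz F = poly_equiv F by exact: poly_equiv_congruence.
  by apply: funext => a; apply: funext => b; apply/propext/leibniz_poly.
- by move=> a b [R [_ FR Rab]]; apply: FR.
Qed.

End Filters.

Section Classes.
Variables (L : language) (l : logic L).

Definition in_Alg (A : algebra L) : Prop :=
  exists F : set A, is_filter l F /\ is_identity (suszko l F).

Definition in_ModStar (A : algebra L) (F : set A) : Prop :=
  is_filter l F /\ is_identity (leibniz F).

Definition interderivable (G : set (form L)) (t u : form L) : Prop :=
  Cn l (G `|` [set t]) u /\ Cn l (G `|` [set u]) t.

Definition selfextensional : Prop :=
  @congruence L (Fm L) (fun t u => Cn l [set t] u /\ Cn l [set u] t).

Definition fully_selfextensional : Prop :=
  forall A : algebra L, in_Alg A ->
  forall a b : A, Fi l [set a] = Fi l [set b] -> a = b.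

Definition fregean : Prop :=
  forall (f : symbol L) (G : set (form L)) (t u : 'I_(arity f) -> form L),
    (forall i, interderivable G (t i) (u i)) ->
    interderivable G (App f t) (App f u).

Definition fully_fregean : Prop :=
  forall A : algebra L, in_Alg A ->
  forall F : set A, is_filter l F ->
  forall a b : A, Fi l (F `|` [set a]) = Fi l (F `|` [set b]) -> suszko l F a b.

(* The variables x, y of rho are 0, 1; the variable x of tau is 0. *)
Definition finitely_algebraizable : Prop :=
  (exists rho : seq (form L),
     (forall t, elems rho t -> vars t `<=` [set 0; 1]) /\
     forall (A : algebra L) (F : set A), is_filter l F ->
     forall a b : A,
       leibniz F a b <->
       (forall t, elems rho t -> F (feval (fun x => if x == 0 then a else b) t)))
  /\
  (exists tau : set (form L * form L),
     (forall e, tau e -> vars e.1 `<=` [set 0] /\ vars e.2 `<=` [set 0]) /\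
     forall (A : algebra L) (F : set A), in_ModStar F ->
       F = [set a | forall e, tau e ->
                      feval (fun=> a) e.1 = feval (fun=> a) e.2]).

End Classes.

Inductive frege_level : Type :=
  Selfextensional | FullySelfextensional | Fregean | FullyFregean.

Definition in_level (K : frege_level) (L : language) (l : logic L) : Prop :=
  match K with
  | Selfextensional => selfextensional l
  | FullySelfextensional => fully_selfextensional l
  | Fregean => fregean l
  | FullyFregean => fully_fregean l
  end.

(* The finite language with [size s] symbols, the [i]-th of arity [s`_i]. *)
Definition fin_language (s : seq nat) : language :=
  @Language 'I_(size s) (fun i => nth 0 s i).

Record fin_calculus : Type := FinCalculus {
  signature : seq nat;
  rules : seq (rule (fin_language signature)) }.

Definition calculus_logic (H : fin_calculus) :
    logic (fin_language (signature H)) :=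
  hilbert_logic (elems (rules H)).

(* [CodeSeq.code] is MathComp's effective bijection from [seq nat] to [nat]. *)
Fixpoint form_code (s : seq nat) (t : form (fin_language s)) : nat :=
  match t with
  | Var x => CodeSeq.code [:: 0; x]
  | App f args =>
      CodeSeq.code ((nat_of_ord f).+1 ::
                    [seq form_code (args i) | i <- enum 'I_(arity f)])
  end.

Definition rule_code (s : seq nat) (r : rule (fin_language s)) : nat :=
  CodeSeq.code (form_code (conclusion r) :: map (@form_code s) (premises r)).

Definition calculus_code (H : fin_calculus) : nat :=
  CodeSeq.code [:: CodeSeq.code (signature H);
                   CodeSeq.code (map (@rule_code _) (rules H))].

Lemma form_code_inj s : injective (@form_code s).
Proof.
elim=> [x|f a IH] [y|g b] /(can_inj CodeSeq.codeK) //=; first by case=> ->.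
case=> /val_inj fg; case: g / fg b => b e; congr App; apply: funext => i.
by apply: IH; move/eq_in_map: e; apply; rewrite mem_enum.
Qed.

Lemma rule_code_inj s : injective (@rule_code s).
Proof.
move=> [p c] [q d] /(can_inj CodeSeq.codeK) [] /form_code_inj /= ->.
by move=> /(inj_map (@form_code_inj s)) ->.
Qed.

Lemma calculus_code_inj : injective calculus_code.
Proof.
move=> [s r] [s' r'] /(can_inj CodeSeq.codeK) [] /(can_inj CodeSeq.codeK) /= ss.
case: s' / ss r' => r' /(can_inj CodeSeq.codeK).
by move=> /(inj_map (@rule_code_inj s)) ->.
Qed.

Inductive recfun : nat -> Type :=
| Zero n : recfun n
| Succ : recfun 1
| Proj n (i : 'I_n) : recfun n
| Comp m n (f : recfun m) (g : 'I_m -> recfun n) : recfun n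
| Prec n (f : recfun n) (g : recfun n.+2) : recfun n.+1
| Min n (f : recfun n.+1) : recfun n.

(* [computes p v y]: the partial function [p] is defined at [v], with value
   [y].  The recursion argument of [Prec] and the search argument of [Min] come
   first. *)
Fixpoint computes n (p : recfun n) : n.-tuple nat -> nat -> Prop :=
  match p in recfun n return n.-tuple nat -> nat -> Prop with
  | Zero _ => fun _ y => y = 0
  | Succ => fun v y => y = (thead v).+1
  | Proj _ i => fun v y => y = tnth v i
  | Comp m _ f g => fun v y =>
      exists w : m.-tuple nat,
        (forall i, computes (g i) v (tnth w i)) /\ computes f w y
  | Prec _ f g => fun v =>
      let w := [tuple of behead v] in
      (fix rec (x : nat) : nat -> Prop :=
         match x with
         | 0 => computes f w
         | x'.+1 => fun y =>
             exists z, rec x' z /\ computes g [tuple of x' :: z :: w] y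
         end) (thead v)
  | Min _ f => fun v y =>
      computes f [tuple of y :: v] 0 /\
      forall x, (x < y)%N -> exists z, computes f [tuple of x :: v] z.+1
  end.

Lemma computes_functional n (p : recfun n) v y y' :
  computes p v y -> computes p v y' -> y = y'.
Proof.
elim: p v y y' => {n} [n||n i|m n f IHf g IHg|n f IHf g IHg|n f IHf] v y y' /=.
- by move=> -> ->.
- by move=> -> ->.
- by move=> -> ->.
- move=> [w [gw fw]] [w' [gw' fw']]; suff ww : w = w'.
    by rewrite -ww in fw'; apply: IHf fw fw'.
  by apply: eq_from_tnth => i; apply: IHg (gw i) (gw' i).
- elim: (thead v) y y' => [|x IH] y y'; first exact: IHf.
  by move=> [z [rz gz]] [z' [/(IH _ _ rz) <- gz']]; apply: IHg gz gz'.
- move=> [fy ly] [fy' ly']; case: (ltngtP y y') => // yy.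
    by have [z /(IHf _ _ _ fy)] := ly' _ yy.
  by have [z /(IHf _ _ _ fy')] := ly _ yy.
Qed.

(* There is an algorithm which, for every input [H] satisfying the promise [P],
   halts and decides whether [Q H]; its behaviour on other inputs is
   irrelevant. *)
Definition decidable_on (P Q : fin_calculus -> Prop) : Prop :=
  exists p : recfun 1, forall H, P H ->
    (Q H -> computes p [tuple calculus_code H] 1) /\
    (~ Q H -> computes p [tuple calculus_code H] 0).

(* Main.v *)
(* Fix a language with zero, successor and pairing for data, an equivalence
   connective E, and a ternary connective R, where R(p, v, y) reads "the program
   p maps v to y".  The rules are those making E an equivalence connective
   (whence finite algebraizability), Horn clauses executing programs, the rule
   R(p, v, 0) |- 0 for a chosen program p and input v, and rules by which 0
   entails every S x, P x y, R x y z and makes E the operation of a Boolean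
   group.  If p outputs 0 on v, then 0 is a theorem, filters are subgroups, and
   the logic lies in all four classes.  Otherwise it has a model on the data
   themselves, where E is equality and S(0) is the only designated value; there
   x and E(x, E(x, x)), which are always interderivable, may differ, so that the
   logic lies in none of the classes.  A decision procedure is refuted by
   letting p apply the procedure to the code of its own calculus: if v is the
   code of p, this code is a computable function of v alone, which makes the
   self-reference possible without a recursion theorem. *)
From mathcomp Require Import all_boot.
From mathcomp Require Import boolp classical_sets.
From Stdlib Require List.
Require Import Defs.

Set Implicit Arguments.
Unset Strict Implicit.
Unset Printing Implicit Defensive.

Local Open Scope classical_set_scope.

(** * Evaluations, rules and filters *)

Section Homomorphisms.
Variable L : language.

Lemma feval_hom (A : algebra L) (v : nat -> A) : @is_hom L (Fm L) A (feval v).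
Proof. by []. Qed.

Lemma hom_feval (A : algebra L) (h : form L -> A) :
  @is_hom L (Fm L) A h -> h = feval (h \o Var).
Proof.
move=> hh; apply: funext; elim=> [//|f a IH] /=.
by rewrite [LHS]hh; congr (op A f _); apply: funext.
Qed.

Lemma feval_Var (t : form L) : @feval L (Fm L) Var t = t.
Proof. by elim: t => // f a IH /=; congr App; apply: funext. Qed.

(** The fold lets [/=] turn a concrete rule into a chain of implications, one per premise. *)
Definition validates (A : algebra L) (F : set A) (r : rule L) : Prop :=
  forall v : nat -> A,
    foldr (fun t (Q : Prop) => F (feval v t) -> Q) (F (feval v (conclusion r)))
          (premises r).

Lemma validatesP (A : algebra L) (F : set A) (r : rule L) :
  validates F r <->
  forall v : nat -> A, (forall t, elems (premises r) t -> F (feval v t)) ->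
                       F (feval v (conclusion r)).
Proof.
case: r => ps c; split=> [Fr v|Fr v]; move: (Fr v) => /=.
  elim: ps {Fr} => [//|t ps IH] /= H Ft.
  by apply: IH => [|u pu]; [apply/H/Ft; left | apply: Ft; right].
elim: ps {Fr} => [|t ps IH] /= H; first exact: H.
by move=> Ft; apply: IH => Fp; apply: H => u /= [<-|/Fp].
Qed.

(** By induction on derivations: a homomorphism after a substitution is again a homomorphism, hence
    an evaluation, so validity of the rules suffices. *)
Lemma hilbert_filterP (A : algebra L) (H : set (rule L)) (F : set A) :
  is_filter (hilbert_logic H) F <-> (forall r, H r -> validates F r).
Proof.
split=> [fF r Hr|HF G t h Gt hh hG].
  apply/validatesP => v Fp.
  apply: (fF (elems (premises r)) _ _ _ (feval_hom v)).
    rewrite -[conclusion r]/(id _); apply: derives_rule => // t rt.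
    exact: derives_hyp.
  by move=> _ [t rt <-]; apply: Fp.
elim: Gt => {t} [t Gt|r s Hr Hs _ IH]; first by apply: hG; exists t.
have hhs : @is_hom L (Fm L) A (h \o s) by move=> f a; rewrite /= Hs hh.
rewrite -[h (s _)]/((h \o s) _) (hom_feval hhs).
by have /validatesP := HF r Hr; apply => t rt; rewrite -hom_feval //; apply: IH.
Qed.

(** Lets results about filters speak of derivability itself, on the formula algebra. *)
Lemma Cn_filter (H : set (rule L)) (G : set (form L)) :
  @is_filter L (Fm L) (hilbert_logic H) (derives H G).
Proof.
apply/hilbert_filterP => r Hr; apply/validatesP => v Fp.
exact: (derives_rule Hr (feval_hom _)).
Qed.

Lemma suszko_anti (l : logic L) (A : algebra L) (F G : set A) (a b : A) :
  F `<=` G -> suszko l F a b -> suszko l G a b.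
Proof. by move=> FG sab K fK GK; apply: sab => //; apply: subset_trans GK. Qed.

End Homomorphisms.

(** * The language and its operations *)

Definition sig := [:: 0; 1; 2; 2; 3].
Definition lang := fin_language sig.
Definition symZ : symbol lang := Ordinal (isT : 0 < 5).
Definition symS : symbol lang := Ordinal (isT : 1 < 5).
Definition symP : symbol lang := Ordinal (isT : 2 < 5).
Definition symE : symbol lang := Ordinal (isT : 3 < 5).
Definition symR : symbol lang := Ordinal (isT : 4 < 5).

Definition args0 T : 'I_0 -> T := fun i => False_rect T (notF (ltn_ord i)).
Definition args1 T (a : T) : 'I_1 -> T := fun=> a.
Definition args2 T (a b : T) : 'I_2 -> T :=
  fun i => if val i is 0 then a else b.
Definition args3 T (a b c : T) : 'I_3 -> T :=
  fun i => match val i with 0 => a | 1 => b | _ => c end.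

Definition i02 : 'I_2 := Ordinal (isT : 0 < 2).
Definition i12 : 'I_2 := Ordinal (isT : 1 < 2).
Definition i03 : 'I_3 := Ordinal (isT : 0 < 3).
Definition i13 : 'I_3 := Ordinal (isT : 1 < 3).
Definition i23 : 'I_3 := Ordinal (isT : 2 < 3).

Lemma args0E T (a : 'I_0 -> T) : a = @args0 T.
Proof. by apply: funext => -[]. Qed.

Lemma args1E T (a : 'I_1 -> T) : a = args1 (a ord0).
Proof. by apply: funext => i; rewrite /args1 (ord1 i). Qed.

Lemma args2E T (a : 'I_2 -> T) : a = args2 (a i02) (a i12).
Proof.
by apply: funext => -[[|[|//]] lti]; rewrite /args2 /=; congr a; apply: val_inj.
Qed.

Lemma args3E T (a : 'I_3 -> T) : a = args3 (a i03) (a i13) (a i23).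
Proof.
by apply: funext => -[[|[|[|//]]] lti]; rewrite /args3 /=; congr a;
  apply: val_inj.
Qed.

Section Operations.
Variable A : algebra lang.

Definition zeroA : A := op A symZ (@args0 A).
Definition sucA (a : A) : A := op A symS (args1 a).
Definition pairA (a b : A) : A := op A symP (args2 a b).
Definition eqvA (a b : A) : A := op A symE (args2 a b).
Definition runA (a b c : A) : A := op A symR (args3 a b c).

Lemma op_ind (Q : forall f : symbol lang, ('I_(arity f) -> A) -> Prop) :
  Q symZ (@args0 A) -> (forall a, Q symS (args1 a)) ->
  (forall a b, Q symP (args2 a b)) -> (forall a b, Q symE (args2 a b)) ->
  (forall a b c, Q symR (args3 a b c)) -> forall f a, Q f a.
Proof.
move=> QZ QS QP QE QR [[|[|[|[|[|//]]]]] ltk] a;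
  rewrite (bool_irrelevance ltk isT) in a *.
- by rewrite [a]args0E.
- by rewrite [a]args1E.
- by rewrite [a]args2E.
- by rewrite [a]args2E.
- by rewrite [a]args3E.
Qed.

End Operations.

Definition tZ : form lang := zeroA (Fm lang).
Definition tS (a : form lang) : form lang := @sucA (Fm lang) a.
Definition tP (a b : form lang) : form lang := @pairA (Fm lang) a b.
Definition tE (a b : form lang) : form lang := @eqvA (Fm lang) a b.
Definition tR (a b c : form lang) : form lang := @runA (Fm lang) a b c.

Section Evaluation.
Variables (A : algebra lang) (v : nat -> A).

Lemma feval_tZ : feval v tZ = zeroA A.
Proof. by rewrite /= [X in op A _ X]args0E. Qed.
Lemma feval_tS a : feval v (tS a) = sucA (feval v a).
Proof. by rewrite /= [X in op A _ X]args1E. Qed.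
Lemma feval_tP a b : feval v (tP a b) = pairA (feval v a) (feval v b).
Proof. by rewrite /= [X in op A _ X]args2E. Qed.
Lemma feval_tE a b : feval v (tE a b) = eqvA (feval v a) (feval v b).
Proof. by rewrite /= [X in op A _ X]args2E. Qed.
Lemma feval_tR a b c :
  feval v (tR a b c) = runA (feval v a) (feval v b) (feval v c).
Proof. by rewrite /= [X in op A _ X]args3E. Qed.
Lemma feval_tVar x : feval v (Var x) = v x.
Proof. by []. Qed.
Definition fevalE :=
  (feval_tZ, feval_tS, feval_tP, feval_tE, feval_tR, feval_tVar).

End Evaluation.

(* Otherwise [/=] unfolds the formulas [tS _], [tP _ _], ... so that [fevalE]
   no longer applies. *)
Arguments feval : simpl never.

(** * Programs and their execution on data *)

Inductive data := Z | S (d : data) | P (d e : data).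

Notation tag0 := Z.
Notation tag1 := (S tag0).
Notation tag2 := (S tag1).
Notation tag3 := (S tag2).
Notation tag4 := (S tag3).
Notation tag5 := (S tag4).
Notation tag6 := (S tag5).
Notation tag7 := (S tag6).

(* [run p v y]: the program [p] maps the list [v] to [y].  A program is a pair
   of a tag and its components.  [P tag3 gs] runs a list [gs] of programs in
   parallel, and [run (P tag6 f) (P y v) Z] says that [f] is positive on
   [P x v] for all [x] below [y]; these two are auxiliary to composition
   ([tag4]) and minimization ([tag7]). *)
Inductive run : data -> data -> data -> Prop :=
| run_zero v : run (P tag0 Z) v Z
| run_succ x v : run (P tag1 Z) (P x v) (S x)
| run_proj0 x v : run (P tag2 Z) (P x v) x
| run_projS i x v y : run (P tag2 i) v y -> run (P tag2 (S i)) (P x v) y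
| run_nil v : run (P tag3 Z) v Z
| run_cons g gs v w ws :
    run g v w -> run (P tag3 gs) v ws -> run (P tag3 (P g gs)) v (P w ws)
| run_comp f gs v w y :
    run (P tag3 gs) v w -> run f w y -> run (P tag4 (P f gs)) v y
| run_prec0 f g v y : run f v y -> run (P tag5 (P f g)) (P Z v) y
| run_precS f g x v z y :
    run (P tag5 (P f g)) (P x v) z -> run g (P x (P z v)) y ->
    run (P tag5 (P f g)) (P (S x) v) y
| run_pos0 f v : run (P tag6 f) (P Z v) Z
| run_posS f x v z :
    run (P tag6 f) (P x v) Z -> run f (P x v) (S z) ->
    run (P tag6 f) (P (S x) v) Z
| run_min f v y :
    run (P tag6 f) (P y v) Z -> run f (P y v) Z -> run (P tag7 f) v y.

Fixpoint quote (d : data) : form lang :=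
  match d with
  | Z => tZ
  | S d => tS (quote d)
  | P d e => tP (quote d) (quote e)
  end.

(** * The calculus attached to a program and an input *)

Definition congruence_rules : seq (rule lang) :=
  let x := Var 0 in let y := Var 1 in let u := Var 2 in let v := Var 3 in
  let z := Var 4 in let w := Var 5 in
  [:: Rule [::] (tE x x);
      Rule [:: x; tE x y] y;
      Rule [:: x; y] (tE x y);
      Rule [:: tE x y] (tE (tS x) (tS y));
      Rule [:: tE x y; tE u v] (tE (tP x u) (tP y v));
      Rule [:: tE x y; tE u v] (tE (tE x u) (tE y v));
      Rule [:: tE x y; tE u v; tE z w] (tE (tR x u z) (tR y v w))].

(* [tZ] plays the role of a falsum, except that what it entails is consistent. *)
Definition collapse_rules : seq (rule lang) :=
  let x := Var 0 in let y := Var 1 in let z := Var 2 in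
  [:: Rule [:: tZ] (tS x);
      Rule [:: tZ] (tP x y);
      Rule [:: tZ] (tR x y z);
      Rule [:: tZ] (tE (tE (tE x y) z) (tE x (tE y z)));
      Rule [:: tZ] (tE (tE x y) (tE y x))].

(** One Horn clause for each constructor of [run], in the same order. *)
Definition run_rules : seq (rule lang) :=
  let f := Var 0 in let g := Var 1 in let v := Var 2 in let w := Var 3 in
  let x := Var 4 in let y := Var 5 in let z := Var 6 in
  let tag k t := tP (quote k) t in
  [:: Rule [::] (tR (tag tag0 tZ) v tZ);
      Rule [::] (tR (tag tag1 tZ) (tP x v) (tS x));
      Rule [::] (tR (tag tag2 tZ) (tP x v) x);
      Rule [:: tR (tag tag2 f) v y] (tR (tag tag2 (tS f)) (tP x v) y);
      Rule [::] (tR (tag tag3 tZ) v tZ);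
      Rule [:: tR f v x; tR (tag tag3 g) v w]
           (tR (tag tag3 (tP f g)) v (tP x w));
      Rule [:: tR (tag tag3 g) v w; tR f w y] (tR (tag tag4 (tP f g)) v y);
      Rule [:: tR f v y] (tR (tag tag5 (tP f g)) (tP tZ v) y);
      Rule [:: tR (tag tag5 (tP f g)) (tP x v) z; tR g (tP x (tP z v)) y]
           (tR (tag tag5 (tP f g)) (tP (tS x) v) y);
      Rule [::] (tR (tag tag6 f) (tP tZ v) tZ);
      Rule [:: tR (tag tag6 f) (tP x v) tZ; tR f (tP x v) (tS z)]
           (tR (tag tag6 f) (tP (tS x) v) tZ);
      Rule [:: tR (tag tag6 f) (tP y v) tZ; tR f (tP y v) tZ]
           (tR (tag tag7 f) v y)].

Definition base_rules := congruence_rules ++ collapse_rules ++ run_rules.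

Definition halt_rule (p v : form lang) : rule lang :=
  Rule [:: tR p v tZ] tZ.

Definition calculus (d e : data) : fin_calculus :=
  @FinCalculus sig (halt_rule (quote d) (quote e) :: base_rules).

(** * Filters of the calculus *)

Section Filters.
Variables (d e : data) (A : algebra lang).
Let l := calculus_logic (calculus d e).

Lemma calculus_filterP (F : set A) :
  is_filter l F <->
  validates F (halt_rule (quote d) (quote e)) /\
  (forall r, elems base_rules r -> validates F r).
Proof.
split=> [/hilbert_filterP HF|[hF bF]].
  by split=> [|r Hr]; apply: HF; [left | right].
by apply/hilbert_filterP => r [<-|/bF].
Qed.

Variable F : set A.
Hypothesis fF : is_filter l F.
Local Notation "a =~ b" := (F (eqvA a b)) (at level 70).

(* [i] is the position of the rule in [base_rules], and [s] lists the values of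
   the variables. *)
Lemma filter_rule i (s : seq A) (a0 : A) :
  i < size base_rules ->
  let: Rule ps c := nth (Rule [::] tZ) base_rules i in
  foldr (fun t (Q : Prop) => F (feval (nth a0 s) t) -> Q)
    (F (feval (nth a0 s) c)) ps.
Proof.
move=> lti; case E: (nth _ _ _) => [ps c].
suff rin : elems base_rules (Rule ps c).
  by case/calculus_filterP: fF => _ bF; apply: (bF _ rin (nth a0 s)).
rewrite -E; elim: base_rules i lti {E} => [|r rs IHs] [|i] //= lti.
  by left.
by right; apply: IHs.
Qed.

Lemma eqv_refl a : a =~ a.
Proof.
have := @filter_rule 0 [:: a] a isT.
by rewrite /= !fevalE.
Qed.

Lemma eqv_mp a b : F a -> a =~ b -> F b.
Proof.
have := @filter_rule 1 [:: a; b] a isT.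
by rewrite /= !fevalE.
Qed.

Lemma eqv_true a b : F a -> F b -> a =~ b.
Proof.
have := @filter_rule 2 [:: a; b] a isT.
by rewrite /= !fevalE.
Qed.

Lemma eqv_suc a b : a =~ b -> sucA a =~ sucA b.
Proof.
have := @filter_rule 3 [:: a; b] a isT.
by rewrite /= !fevalE.
Qed.

Lemma eqv_pair a b a' b' : a =~ b -> a' =~ b' -> pairA a a' =~ pairA b b'.
Proof.
have := @filter_rule 4 [:: a; b; a'; b'] a isT.
by rewrite /= !fevalE.
Qed.

Lemma eqv_eqv a b a' b' : a =~ b -> a' =~ b' -> eqvA a a' =~ eqvA b b'.
Proof.
have := @filter_rule 5 [:: a; b; a'; b'] a isT.
by rewrite /= !fevalE.
Qed.

Lemma eqv_run a b a' b' a'' b'' :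
  a =~ b -> a' =~ b' -> a'' =~ b'' -> runA a a' a'' =~ runA b b' b''.
Proof.
have := @filter_rule 6 [:: a; b; a'; b'; a''; b''] a isT.
by rewrite /= !fevalE.
Qed.

(** [eqvA a a] is designated, and replacing its first argument by [b] preserves this. *)
Lemma eqv_sym a b : a =~ b -> b =~ a.
Proof.
by move=> ab; apply: eqv_mp (eqv_refl a) (eqv_eqv ab (eqv_refl a)).
Qed.

Lemma eqv_trans b a c : a =~ b -> b =~ c -> a =~ c.
Proof. by move=> ab bc; apply: eqv_mp ab (eqv_eqv (eqv_refl a) bc). Qed.

Lemma eqv_congruence : congruence (fun a b => a =~ b).
Proof.
split; [exact: eqv_refl | exact: eqv_sym | by move=> a b c; apply: eqv_trans |].
move=> f a.
elim/op_ind: f / a => [b _|a b ab|a a' b ab|a a' b ab|a a' a'' b ab].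
- by rewrite [b]args0E; apply: eqv_refl.
- by rewrite [b]args1E; apply: eqv_suc; apply: ab.
- by rewrite [b]args2E; apply: eqv_pair; [apply: (ab i02) | apply: (ab i12)].
- by rewrite [b]args2E; apply: eqv_eqv; [apply: (ab i02) | apply: (ab i12)].
- by rewrite [b]args3E; apply: eqv_run;
    [apply: (ab i03) | apply: (ab i13) | apply: (ab i23)].
Qed.

(** A compatible congruence relating [a] and [b] relates the designated [eqvA a a] to [eqvA a b];
    conversely, [=~] is itself a congruence, compatible by detachment. *)
Lemma leibniz_eqv a b : leibniz F a b <-> a =~ b.
Proof.
split=> [[R [cR FR Rab]]|ab].
  apply: FR (eqv_refl a); apply: (@congr_op _ _ _ cR symE) => i.
  by rewrite /args2; case: (val i) => [|_] //; apply: congr_refl cR a.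
exists (fun a b => a =~ b); split=> //; first exact: eqv_congruence.
by move=> x y xy Fx; apply: eqv_mp xy.
Qed.

Lemma collapse_filter a b :
  F (zeroA A) -> Fi l (F `|` [set a]) = Fi l (F `|` [set b]) -> a =~ b.
Proof.
move=> FZ.
have FS x : F (sucA x).
  have := @filter_rule 7 [:: x] x isT.
  by rewrite /= !fevalE; apply.
have FP x y : F (pairA x y).
  have := @filter_rule 8 [:: x; y] x isT.
  by rewrite /= !fevalE; apply.
have FR x y z : F (runA x y z).
  have := @filter_rule 9 [:: x; y; z] x isT.
  by rewrite /= !fevalE; apply.
have assoc x y z : eqvA (eqvA x y) z =~ eqvA x (eqvA y z).
  have := @filter_rule 10 [:: x; y; z] x isT.
  by rewrite /= !fevalE; apply.
have comm x y : eqvA x y =~ eqvA y x.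
  have := @filter_rule 11 [:: x; y] x isT.
  by rewrite /= !fevalE; apply.
(* This interchange of the inner arguments is what closes [G c] under the compatibility rule for
   [eqvA]. *)
have medial x y u v :
    eqvA (eqvA x u) (eqvA y v) =~ eqvA (eqvA x y) (eqvA u v).
  apply: eqv_trans (eqv_sym (assoc _ _ _)).
  apply: eqv_trans (assoc _ _ _) (eqv_eqv (eqv_refl _) _).
  apply: eqv_trans (eqv_sym (assoc _ _ _)) _.
  exact: eqv_trans (eqv_eqv (comm _ _) (eqv_refl _)) (assoc _ _ _).
have unit x y : F x -> eqvA x y =~ y.
  move=> Fx; apply: eqv_mp (eqv_sym (assoc _ _ _)).
  exact: eqv_true Fx (eqv_refl _).
(* Modulo [F] the algebra is now a Boolean group, and [G c] is the filter
   generated by [F] and [c]. *)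
pose G c : set A := [set x | F x \/ c =~ x].
have GE c x y : x =~ y -> G c x -> G c y.
  by move=> xy [/eqv_mp /(_ xy)|/eqv_trans /(_ xy)]; [left | right].
have Geqv c x y : G c x -> G c y -> G c (eqvA x y).
  move=> [Fx|cx] [Fy|cy].
  - by left; apply: eqv_true.
  - by right; apply: eqv_trans cy (eqv_sym (unit _ _ Fx)).
  - right; apply: eqv_trans cx _.
    exact: eqv_trans (eqv_sym (unit _ _ Fy)) (comm _ _).
  - by left; apply: eqv_trans (eqv_sym cx) cy.
have Gfilter c : is_filter l (G c).
  apply/calculus_filterP; split; first by move=> v /= _; left; rewrite fevalE.
  apply/List.Forall_forall; rewrite /base_rules /=.
  (* Most rules already have their conclusion in [F]; there remain detachment, the introduction of
     [eqvA] and its compatibility with itself. *)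
  do ![apply: List.Forall_cons | exact: List.Forall_nil] => v /=;
    rewrite !fevalE;
    try (by move=> *; left; do ?[exact: assoc | exact: comm | exact: eqv_refl
                      |apply: eqv_true]).
  - move=> [Fx|cx] [Fxy|cxy].
    + by left; apply: eqv_mp Fxy.
    + by right; apply: eqv_trans cxy (unit _ _ Fx).
    + by right; apply: eqv_trans cx Fxy.
    + by left; apply: eqv_mp cx (eqv_mp cxy (eqv_sym (assoc _ _ _))).
  - exact: Geqv.
  - by move=> xy uv; apply: GE (eqv_sym (medial _ _ _ _)) (Geqv _ _ _ xy uv).
have FG c : F `|` [set c] `<=` G c.
  by move=> x [Fx|->]; [left | right; apply: eqv_refl].
move=> Fab.
have Gab : G a b.
  have : Fi l (F `|` [set b]) b by move=> K [_]; apply; right.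
  by rewrite -Fab; apply.
have Gba : G b a.
  have : Fi l (F `|` [set a]) a by move=> K [_]; apply; right.
  by rewrite Fab; apply.
case: Gab Gba => [Fb|//] [Fa|/eqv_sym //]; exact: eqv_true.
Qed.

End Filters.

(** * All four levels when 0 is a theorem *)

Section Collapse.
Variables (d e : data).
Let l := calculus_logic (calculus d e).
Hypothesis thmZ : Cn l set0 tZ.

Lemma collapse_zero (A : algebra lang) (F : set A) :
  is_filter l F -> F (zeroA A).
Proof.
move=> fF; rewrite -(feval_tZ (fun=> zeroA A)).
by apply: (fF _ _ _ thmZ (feval_hom _)) => y [x []].
Qed.

Lemma collapse_fregean_filter (A : algebra lang) (F : set A) (a b : A) :
  is_filter l F ->
  Fi l (F `|` [set a]) = Fi l (F `|` [set b]) -> suszko l F a b.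
Proof.
move=> fF Fab G fG FG; apply/(leibniz_eqv fG)/FG.
by apply: (collapse_filter fF) => //; apply: collapse_zero.
Qed.

Lemma collapse_fully_fregean : fully_fregean l.
Proof. by move=> A _ F fF a b; apply: collapse_fregean_filter. Qed.

(** The Fregean property is applied to the least filter, which adds nothing to what [a] or [b]
    generates. Suszko congruences grow with the filter, so the identity at [F] forces [a = b]. *)
Lemma collapse_fully_selfextensional : fully_selfextensional l.
Proof.
move=> A [F [fF idF]] a b ab; apply/idF.
have sub0 : Fi l set0 `<=` F by apply: smallest_sub.
apply: (suszko_anti sub0); apply: collapse_fregean_filter.
  exact: Fi_filter.
suff Fi0 (c : A) : Fi l (Fi l set0 `|` [set c]) = Fi l [set c] by rewrite !Fi0.
apply/seteqP; split=> x Fx K [fK cK]; apply: Fx; split=> //.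
  by move=> y [y0|/cK //]; apply: y0; split=> // z [].
by move=> y yc; apply: cK; right.
Qed.

(** This is [collapse_filter] on the formula algebra: formulas interderivable over [G] generate the
    same filter over the theory of [G]. *)
Lemma interderivable_eqv G t u :
  interderivable l G t u -> Cn l G (tE t u).
Proof.
have fG X : @is_filter _ (Fm lang) l (Cn l X) by exact: Cn_filter.
have sub X Y : Cn l (X `|` [set Y]) `<=` @Fi _ (Fm lang) l (Cn l X `|` [set Y]).
  move=> w Xw K [fK XK].
  apply: (fK _ _ id Xw) => // _ [x [Xx|xY] <-]; apply: XK; last by right.
  by left; apply: Cn_ext.
move=> [tu ut]; apply: (collapse_filter (fG G)); first exact: collapse_zero.
have half x y : Cn l (G `|` [set y]) x ->
    @Fi _ (Fm lang) l (Cn l G `|` [set x]) `<=`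
    @Fi _ (Fm lang) l (Cn l G `|` [set y]).
  move=> /sub xy w wx K [fK yK]; apply: wx; split=> // z [Gz|->].
    by apply: yK; left.
  exact: xy.
by apply/seteqP; split; apply: half.
Qed.

(** Interderivability over [G] amounts to derivability of [tE], which is a congruence. *)
Lemma collapse_fregean : fregean l.
Proof.
move=> f G t u tu.
have fG X : @is_filter _ (Fm lang) l (Cn l X) by exact: Cn_filter.
have cG := eqv_congruence (fG G).
have ftu : Cn l G (tE (App f t) (App f u)).
  by apply: (congr_op cG) => i; apply: interderivable_eqv.
have step x y : Cn l G (tE x y) -> Cn l (G `|` [set x]) y.
  move=> xy.
  apply: (eqv_mp (fG _) (a := x)); first by apply: Cn_ext; right.
  by apply: (Cn_mono _ xy) => z; left.
by split; apply: step => //; apply: (congr_sym cG).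
Qed.

Lemma collapse_selfextensional : selfextensional l.
Proof.
split=> [t|t u [tu ut]|t u v [tu ut] [uv vu]|f t u tu].
- by split; apply: Cn_ext.
- by split.
- by split; [apply: (Cn_idem (Cn_mono _ uv)) | apply: (Cn_idem (Cn_mono _ ut))];
    move=> _ ->.
- have := @collapse_fregean f set0 t u; rewrite /interderivable !set0U; apply.
  by move=> i; rewrite !set0U; apply: tu.
Qed.

Lemma collapse_in_level (K : frege_level) : in_level K l.
Proof.
case: K; [exact: collapse_selfextensional
  | exact: collapse_fully_selfextensional | exact: collapse_fregean
  | exact: collapse_fully_fregean].
Qed.

End Collapse.

(** * Models, consistency and algebraizability *)

Section Structures.
Variables (T : Type) (z : T) (s : T -> T) (p e : T -> T -> T).
Variable r : T -> T -> T -> T.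

(** The index of the symbol selects the operation; the last branch lies outside the signature. *)
Definition structure : algebra lang :=
  @Algebra lang T
    (fun f : 'I_5 =>
       match val f as k return ('I_(nth 0 sig k) -> T) -> T with
       | 0 => fun=> z
       | 1 => fun a : 'I_1 -> T => s (a ord0)
       | 2 => fun a : 'I_2 -> T => p (a i02) (a i12)
       | 3 => fun a : 'I_2 -> T => e (a i02) (a i12)
       | 4 => fun a : 'I_3 -> T => r (a i03) (a i13) (a i23)
       | _ => fun=> z
       end)
    (inhabits z).

Lemma structure_zero : zeroA structure = z. Proof. by []. Qed.
Lemma structure_suc a : @sucA structure a = s a. Proof. by []. Qed.
Lemma structure_pair a b : @pairA structure a b = p a b. Proof. by []. Qed.
Lemma structure_eqv a b : @eqvA structure a b = e a b. Proof. by []. Qed.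
Lemma structure_run a b c : @runA structure a b c = r a b c.
Proof. by []. Qed.
Definition structureE := (structure_zero, structure_suc, structure_pair,
  structure_eqv, structure_run).

End Structures.

Definition truth (Q : Prop) : data := if `[< Q >] then S Z else Z.

Lemma truthE (Q : Prop) : (truth Q = S Z) = Q.
Proof. by apply/propext; rewrite /truth; case: asboolP. Qed.

(* With the filter [set S Z], equivalence is equality in this model. *)
Definition data_model : algebra lang :=
  structure Z S P (fun a b => truth (a = b)) (fun a b c => truth (run a b c)).

Lemma quote_data_model (v : nat -> data_model) d : feval v (quote d) = d.
Proof.
elim: d => [|d IH|d IHd e IHe] /=; rewrite fevalE structureE //.
  by rewrite IH.
by rewrite IHd IHe.
Qed.

(** [Z] is not designated, so the collapse rules hold vacuously; the halting rule holds because
    [run d e Z] fails, and the run rules mirror the constructors of [run]. *)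
Lemma data_model_filter (d e : data) :
  ~ run d e Z ->
  is_filter (calculus_logic (calculus d e)) ([set S Z] : set data_model).
Proof.
move=> nrun; apply/calculus_filterP; split.
  by move=> v /=; rewrite !fevalE !quote_data_model !structureE truthE.
apply/List.Forall_forall; rewrite /base_rules /=.
do ![apply: List.Forall_cons | exact: List.Forall_nil] => v /=;
  rewrite !fevalE ?structureE /= ?truthE //;
  first [congruence | by do 2!move=> -> | by do 3!move=> ->
        | by intros; econstructor; eassumption].
Qed.

(** The two-element model with the biconditional for [E] and all else constantly true validates
    every rule, whether or not the program outputs 0. *)
Lemma calculus_consistent (d e : data) :
  consistent (calculus_logic (calculus d e)).
Proof.
pose A := structure true (fun=> true) (fun _ _ => true) eqb
  (fun _ _ _ => true).
have fA : is_filter (calculus_logic (calculus d e)) ([set true] : set A).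
  apply/calculus_filterP; split.
    by move=> v /=; rewrite fevalE.
  apply/List.Forall_forall; rewrite /base_rules /=.
  do ![apply: List.Forall_cons | exact: List.Forall_nil] => v /=;
    rewrite !fevalE ?structureE //=;
    by do ![case: (v _) => //=].
exists (Var 0) => thm.
suff: ([set true] : set A) (feval (fun=> false : A) (Var 0)) by [].
by apply: (fA _ _ _ thm (feval_hom _)) => x [y []].
Qed.

Lemma calculus_finitely_algebraizable (d e : data) :
  finitely_algebraizable (calculus_logic (calculus d e)).
Proof.
split.
  exists [:: tE (Var 0) (Var 1)]; split=> [t [<-|//] x /= [i _]|A F fF a b].
    by rewrite /args2; case: (val i) => [|_] /= ->; [left | right].
  rewrite (leibniz_eqv fF); split=> [ab t [<-|//]|]; first by rewrite fevalE.
  by move=> /(_ _ (or_introl erefl)); rewrite fevalE.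
(* In a reduced matrix a designated [a] is equivalent, hence equal, to the designated [eqvA a a]. *)
exists [set (Var 0, tE (Var 0) (Var 0))]; split.
  move=> _ -> /=; split=> // x [i _].
  by rewrite /args2; case: (val i).
move=> A F [fF idF]; apply/seteqP; split=> [a Fa _ ->|a /(_ _ erefl)] /=.
  rewrite !fevalE; apply/idF/(leibniz_eqv fF).
  exact: (eqv_true fF Fa (eqv_refl fF _)).
by rewrite !fevalE => ->; apply: (eqv_refl fF).
Qed.

(** * Simulation of recursive functions by [run] *)

Fixpoint num (n : nat) : data := if n is n'.+1 then S (num n') else Z.

Definition data_list (s : seq data) : data := foldr P Z s.

Definition vec (s : seq nat) : data := data_list (map num s).

Fixpoint enc n (p : recfun n) : data :=
  match p with
  | Zero _ => P tag0 Z
  | Succ => P tag1 Z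
  | Proj _ i => P tag2 (num i)
  | Comp m _ f g =>
      P tag4 (P (enc f) (data_list [seq enc (g i) | i <- enum 'I_m]))
  | Prec _ f g => P tag5 (P (enc f) (enc g))
  | Min _ f => P tag7 (enc f)
  end.

Lemma run_proj (s : seq nat) i :
  i < size s -> run (P tag2 (num i)) (vec s) (num (nth 0 s i)).
Proof.
elim: s i => [|x s IH] [|i] //= lti; first exact: run_proj0.
exact/run_projS/IH.
Qed.

(** The anonymous fixpoint inside [computes], named for inductions on the recursion argument. *)
Definition prec_rel n (f : recfun n) (g : recfun n.+2) (w : n.-tuple nat) :=
  fix rec (x : nat) : nat -> Prop :=
    match x with
    | 0 => computes f w
    | x'.+1 => fun y =>
        exists z, rec x' z /\ computes g [tuple of x' :: z :: w] y
    end.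

Lemma computes_Prec n (f : recfun n) (g : recfun n.+2) x (v : n.-tuple nat) :
  computes (Prec f g) [tuple of x :: v] = prec_rel f g v x.
Proof.
rewrite -[LHS]/(prec_rel f g [tuple of behead [tuple of x :: v]]
  (thead [tuple of x :: v])) theadE.
by congr prec_rel; apply: val_inj.
Qed.

Lemma computes_run n (p : recfun n) (v : n.-tuple nat) y :
  computes p v y -> run (enc p) (vec v) (num y).
Proof.
elim: p v y => {n} [n||n i|m n f IHf g IHg|n f IHf g IHg|n f IHf] v y.
- by move=> /= ->; apply: run_zero.
- by case/tupleP: v => x v /=; rewrite theadE => ->; apply: run_succ.
- by move=> /= ->; rewrite (tnth_nth 0); apply: run_proj; rewrite size_tuple.
- move=> /= [w [gw fw]]; apply: run_comp (IHf _ _ fw).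
  (* Programs and values become maps over one enumeration of the indices, on which the induction
     runs. *)
  rewrite -[in vec w](map_tnth_enum w) /vec.
  elim: (enum _) => [|i r IHr] /=; first exact: run_nil.
  by apply: run_cons => //; apply: IHg.
- case/tupleP: v => x v; rewrite computes_Prec.
  elim: x y => [|x IHx] y /=; first by move=> /IHf; apply: run_prec0.
  by move=> [z [/IHx xz /IHg zy]]; apply: run_precS xz zy.
- move=> /= [/IHf fy lty]; apply: run_min (fy).
  have: forall x, x < y -> exists z, run (enc f) (vec (x :: v)) (num z.+1).
    by move=> x /lty [z /IHf]; exists z.
  elim: y {fy lty} => [|y IHy] lty; first exact: run_pos0.
  have [z yz] := lty _ (ltnSn y).
  by apply: run_posS yz; apply: IHy => x xy; apply: lty; apply: ltnW.
Qed.

Lemma run_cons_inv g gs v y :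
  run (P tag3 (P g gs)) v y ->
  exists w ws, [/\ y = P w ws, run g v w & run (P tag3 gs) v ws].
Proof. by inversion 1; do 2!eexists; split. Qed.

Lemma run_comp_inv f gs v y :
  run (P tag4 (P f gs)) v y ->
  exists2 w, run (P tag3 gs) v w & run f w y.
Proof. by inversion 1; eexists; eassumption. Qed.

Lemma run_precS_inv f g x v y :
  run (P tag5 (P f g)) (P (S x) v) y ->
  exists2 z, run (P tag5 (P f g)) (P x v) z & run g (P x (P z v)) y.
Proof. by inversion 1; eexists; eassumption. Qed.

Lemma run_pos_inv f y v :
  run (P tag6 f) (P y v) Z ->
  y = Z \/ exists x z,
    [/\ y = S x, run (P tag6 f) (P x v) Z & run f (P x v) (S z)].
Proof.
by inversion 1; [left | right; do 2!eexists; split; first by []; eassumption].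
Qed.

Lemma run_min_inv f v y :
  run (P tag7 f) v y -> run (P tag6 f) (P y v) Z /\ run f (P y v) Z.
Proof. by inversion 1. Qed.

(** Data need not be numerals, so the induction also has to show that outputs are. *)
Lemma run_computes n (p : recfun n) (v : n.-tuple nat) c :
  run (enc p) (vec v) c -> exists2 y, c = num y & computes p v y.
Proof.
elim: p v c => {n} [n||n i|m n f IHf g IHg|n f IHf g IHg|n f IHf] v c.
- by move=> /=; inversion_clear 1; exists 0.
- by case/tupleP: v => x v /=; inversion_clear 1; exists x.+1;
    rewrite /= ?theadE.
- move=> /= ri; exists (tnth v i) => //; rewrite (tnth_nth 0).
  have : i < size v by rewrite size_tuple.
  elim: (val v) (val i) c ri => [|x s IHs] [|k] c //= ri lti.
    by inversion ri.
  by apply: IHs => //; inversion ri.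
- move=> /run_comp_inv [w gw fw].
  (* The default [i0] is quantified because ['I_m] may be empty. *)
  have [ws [wws sws Hws]] : exists ws : seq nat,
    [/\ w = vec ws, size ws = size (enum 'I_m) &
     forall i0 k, k < size ws ->
       computes (g (nth i0 (enum 'I_m) k)) v (nth 0 ws k)].
    elim: (enum _) w gw {fw} => [|i r IHr] w /=.
      by inversion_clear 1; exists [::].
    move=> /run_cons_inv [w1 [ws [-> gw rw]]].
    have [y -> yc] := IHg _ _ _ gw; have [ws' [-> sz H]] := IHr _ rw.
    by exists (y :: ws'); split=> [|/=|i0 [|k]] //; [rewrite sz | apply: H].
  have szw : size ws == m by rewrite sws size_enum_ord.
  rewrite wws in fw; have [y -> yc] := IHf (Tuple szw) _ fw.
  exists y => //; exists (Tuple szw); split=> // i.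
  rewrite (tnth_nth 0) /=; have := Hws i i; rewrite nth_ord_enum.
  by apply; rewrite (eqP szw).
- case/tupleP: v => x v.
  have -> : computes (Prec f g) [tuple of x :: v] = prec_rel f g v x.
    exact: computes_Prec.
  elim: x c => [|x IHx] c; first by inversion_clear 1; apply: (IHf v).
  move=> /run_precS_inv [z xz gz].
  have [y zy yc] := IHx _ xz; rewrite zy in gz.
  have [y' -> yc'] := IHg [tuple of x :: y :: v] _ gz.
  by exists y' => //; exists y.
- move=> /run_min_inv [pos fc].
  (* Positivity below [c] strips successors from [c] down to [Z], which forces [c] to be a
     numeral. *)
  have {pos} [y cy pos] : exists2 y, c = num y &
      forall x, x < y -> exists z, computes f [tuple of x :: v] z.+1.
    elim: c pos {fc} => [|c IHc|c _ e _] /run_pos_inv [|[x [z [//]]]] //.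
      by exists 0.
    move=> [<-] {x} /IHc [y cy lty] fc; rewrite cy in fc *.
    have [[|z'] // _ fz'] := IHf [tuple of y :: v] _ fc.
    exists y.+1 => // x; rewrite ltnS leq_eqVlt => /orP[/eqP ->|/lty //].
    by exists z'.
  rewrite {c}cy in fc *; have [[|z] // _ f0] := IHf [tuple of y :: v] _ fc.
  by exists y.
Qed.

(** * Runs and membership in the hierarchy *)

Section RunFilter.
Variables (d e : data) (A : algebra lang) (F : set A).
Hypothesis fF : is_filter (calculus_logic (calculus d e)) F.

Lemma run_filter (a b c : data) :
  run a b c ->
  forall v : nat -> A, F (feval v (tR (quote a) (quote b) (quote c))).
Proof.
move=> abc v; rewrite fevalE.
pose q d : A := feval v (quote d); rewrite -!/(q _).
have qZ : q Z = zeroA A by rewrite /q /= fevalE.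
have qS t : q (S t) = sucA (q t) by rewrite /q /= fevalE.
have qP t u : q (P t u) = pairA (q t) (q u) by rewrite /q /= fevalE.
(* The arguments follow the variables of [run_rules], with [Z] for those absent from a rule.
   Positions start at 12, after 7 congruence and 5 collapse rules. *)
have R f g v w x y z i :=
  @filter_rule _ _ _ _ fF i [:: q f; q g; q v; q w; q x; q y; q z] (q Z).
elim: abc => {a b c}.
- by move=> u; have := R Z Z u Z Z Z Z 12 isT; rewrite /= !fevalE !(qZ, qS, qP).
- move=> x u; have := R Z Z u Z x Z Z 13 isT.
  by rewrite /= !fevalE !(qZ, qS, qP).
- move=> x u; have := R Z Z u Z x Z Z 14 isT.
  by rewrite /= !fevalE !(qZ, qS, qP).
- move=> i x u y _; have := R i Z u Z x y Z 15 isT.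
  by rewrite /= !fevalE !(qZ, qS, qP).
- by move=> u; have := R Z Z u Z Z Z Z 16 isT; rewrite /= !fevalE !(qZ, qS, qP).
- move=> g gs u w ws _ + _; have := R g gs u ws w Z Z 17 isT.
  by rewrite /= !fevalE !(qZ, qS, qP).
- move=> f gs u w y _ + _; have := R f gs u w Z y Z 18 isT.
  by rewrite /= !fevalE !(qZ, qS, qP).
- move=> f g u y _; have := R f g u Z Z y Z 19 isT.
  by rewrite /= !fevalE !(qZ, qS, qP).
- move=> f g x u z y _ + _; have := R f g u Z x y z 20 isT.
  by rewrite /= !fevalE !(qZ, qS, qP).
- move=> f u; have := R f Z u Z Z Z Z 21 isT.
  by rewrite /= !fevalE !(qZ, qS, qP).
- move=> f x u z _ + _; have := R f Z u Z x Z z 22 isT.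
  by rewrite /= !fevalE !(qZ, qS, qP).
- move=> f u y _ + _; have := R f Z u Z Z y Z 23 isT.
  by rewrite /= !fevalE !(qZ, qS, qP).
Qed.

End RunFilter.

Lemma run_calculus_in_level (d e : data) (K : frege_level) :
  run d e Z -> in_level K (calculus_logic (calculus d e)).
Proof.
move=> de; apply: collapse_in_level.
have fC : @is_filter _ (Fm lang) (calculus_logic (calculus d e))
    (derives (elems (rules (calculus d e))) set0) by apply: Cn_filter.
have := run_filter fC de (@Var lang); rewrite feval_Var => dR.
case/calculus_filterP: fC => /(_ (@Var lang)) /= + _.
by rewrite !feval_Var; apply.
Qed.

Lemma nrun_calculus_notin_level (d e : data) (K : frege_level) :
  ~ run d e Z -> ~ in_level K (calculus_logic (calculus d e)).
Proof.
set l := calculus_logic _ => nrun.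
pose T : set data_model := [set S Z].
have fT : is_filter l T by apply: data_model_filter.
have leibT (a b : data_model) : leibniz T a b -> a = b.
  by move=> /(leibniz_eqv fT); rewrite structureE /T /= truthE.
have algD : in_Alg l data_model.
  exists T; split=> // a b; split=> [/(_ T fT) ab|-> G fG _].
    by apply: leibT; apply: ab.
  by apply/(leibniz_eqv fG)/(eqv_refl fG).
(* Interderivable with [x], since every filter contains [eqvA x x]. *)
pose x1 (A : algebra lang) (x : A) := eqvA x (eqvA x x).
have x1P (A : algebra lang) (F : set A) x : is_filter l F -> F x <-> F (x1 A x).
  move=> fF; split=> Fx; first exact: (eqv_true fF Fx (eqv_refl fF _)).
  exact: (eqv_mp fF (eqv_refl fF x) (eqv_sym fF Fx)).
have FiE (F : set data_model) x :
    Fi l (F `|` [set x]) = Fi l (F `|` [set x1 _ x]).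
  apply/seteqP; split=> y Fy G [fG FxG]; apply: Fy; split=> // z [Fz|->].
  - by apply: FxG; left.
  - by apply: (proj2 (x1P _ _ _ fG)); apply: FxG; right.
  - by apply: FxG; left.
  - by apply: (proj1 (x1P _ _ _ fG)); apply: FxG; right.
(* [two] differs from [S Z], the value of [eqvA two two], so comparing these yields [Z]. *)
pose two : data_model := S (S Z).
have x1two : x1 data_model two = Z.
  rewrite /x1 !structureE /truth.
  by case: asboolP => [|//]; case: asboolP.
(* [S] tells the pair apart: it takes [Z] to the designated [S Z], but [two] to an undesignated
   element. *)
have nself : ~ (Cn l [set tS (x1 (Fm lang) (Var 0))] (tS (Var 0))).
  move=> thm; suff : T (S two) by [].
  have /= := fT _ _ _ thm (feval_hom (fun=> two)).
  rewrite !fevalE; apply=> _ [_ -> <-] /=; rewrite !fevalE.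
  by rewrite -/(x1 data_model two) x1two.
have interd G : interderivable l G (Var 0) (x1 (Fm lang) (Var 0)).
  have fG X : @is_filter _ (Fm lang) l (Cn l X) by apply: Cn_filter.
  split; first by apply: (proj1 (x1P _ _ _ (fG _))); apply: Cn_ext; right.
  by apply: (proj2 (x1P _ _ _ (fG _))); apply: Cn_ext; right.
case: K => /=.
- move=> cl; apply: nself.
  have [] // := @congr_op _ _ _ cl symS (args1 (Var 0))
    (args1 (x1 (Fm lang) (Var 0))).
  by move=> i; have := interd set0; rewrite /interderivable !set0U.
- move=> /(_ _ algD two Z) /=; rewrite -x1two -[[set two]]set0U FiE set0U.
  by rewrite x1two => /(_ erefl).
- move=> /(_ symS set0 (args1 (Var 0)) (args1 (x1 (Fm lang) (Var 0)))).
  rewrite /interderivable !set0U => fr; apply: nself; apply: (proj2 (fr _)).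
  by move=> i; have := interd set0; rewrite /interderivable !set0U.
- move=> /(_ _ algD T fT two (x1 _ two) (FiE _ _) T fT) /(_ (fun _ => id)).
  by move=> /leibT; rewrite x1two.
Qed.

(** * Computability of the self-referential code *)

Definition computable (f : nat -> nat) : Prop :=
  exists p : recfun 1, forall x, computes p [tuple x] (f x).

Definition computable2 (f : nat -> nat -> nat) : Prop :=
  exists p : recfun 2, forall x y, computes p [tuple x; y] (f x y).

Lemma eq_computable f g : f =1 g -> computable f -> computable g.
Proof. by move=> /funext ->. Qed.

Lemma computable_id : computable id.
Proof. by exists (Proj ord0). Qed.

Lemma computable_succ : computable succn.
Proof. by exists Succ. Qed.

Lemma computable_comp f g :
  computable f -> computable g -> computable (fun x => f (g x)).
Proof.
move=> [p fp] [q gq]; exists (Comp p (fun _ : 'I_1 => q)) => x.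
by exists [tuple g x]; split=> // i; rewrite (ord1 i).
Qed.

Lemma computable_const c : computable (fun=> c).
Proof.
elim: c => [|c IHc]; first by exists (Zero 1).
exact: (computable_comp computable_succ IHc).
Qed.

Lemma computable_comp2 f g h :
  computable2 f -> computable g -> computable h ->
  computable (fun x => f (g x) (h x)).
Proof.
move=> [p fp] [q gq] [r hr]; exists (Comp p (args2 q r)) => x.
exists [tuple g x; h x]; split=> // -[[|[|//]] lti] /=;
  by rewrite (tnth_nth 0) /=.
Qed.

Lemma computable_iter h b :
  computable h -> computable b -> computable2 (fun x y => iter x h (b y)).
Proof.
move=> [p hp] [q bq].
(* The step receives the counter, the previous value and the parameter; index 1 selects the previous
   value. *)
exists (Prec q (Comp p (fun _ : 'I_1 => Proj (Ordinal (isT : 1 < 3))))) => x y.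
rewrite (computes_Prec _ _ x [tuple y]).
elim: x => [|x IHx] /=; first exact: bq.
exists (iter x h (b y)); split=> //.
exists [tuple iter x h (b y)]; split=> // i.
by rewrite (ord1 i) /= !(tnth_nth 0).
Qed.

Lemma computable_iter1 h c :
  computable h -> computable (fun x => iter x h c).
Proof.
move=> hh; apply: (computable_comp2 (f := fun x y => iter x h y)).
- exact: (computable_iter hh computable_id).
- exact: computable_id.
- exact: computable_const.
Qed.

(** [CodeSeq.code (x :: s)] is [2 ^ x * (CodeSeq.code s).*2.+1], obtained from an odd number by [x]
    doublings. *)
Lemma computable_code_cons f g :
  computable f -> computable (fun x => CodeSeq.code (g x)) ->
  computable (fun x => CodeSeq.code (f x :: g x)).
Proof.
have double_computable : computable double.
  have S2 := computable_comp computable_succ computable_succ.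
  apply: eq_computable (computable_iter1 0 S2).
  by elim=> [//|x IHx]; rewrite iterS IHx doubleS.
have odd_computable : computable (fun y => y.*2.+1).
  exact: computable_comp computable_succ double_computable.
have code2 := computable_iter double_computable odd_computable.
move=> fc gc; apply: eq_computable (computable_comp2 code2 fc gc).
move=> x /=; elim: (f x) => [|n IHn]; first by rewrite mul1n.
by rewrite iterS IHn expnS -mulnA mul2n.
Qed.

(** The leading number is one more than the index of the symbol, as 0 marks variables. *)
Lemma form_codeS a :
  @form_code sig (tS a) = CodeSeq.code [:: 2; form_code a].
Proof. by rewrite [LHS]/= enum_ordSl enum_ord0. Qed.

Lemma form_codeP a b :
  @form_code sig (tP a b) = CodeSeq.code [:: 3; form_code a; form_code b].
Proof. by rewrite [LHS]/= !enum_ordSl enum_ord0. Qed.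

Lemma form_codeR a b c :
  @form_code sig (tR a b c) =
  CodeSeq.code [:: 5; form_code a; form_code b; form_code c].
Proof. by rewrite [LHS]/= !enum_ordSl enum_ord0. Qed.

Lemma computable_num_code :
  computable (fun m => @form_code sig (quote (num m))).
Proof.
have step : computable (fun c => CodeSeq.code [:: 2; c]).
  apply: (computable_code_cons (g := fun c => [:: c])).
    exact: computable_const.
  apply: (computable_code_cons (g := fun=> [::]) computable_id).
  exact: computable_const.
apply: eq_computable (computable_iter1 (@form_code sig tZ) step).
by elim=> [//|m IHm]; rewrite iterS IHm -form_codeS.
Qed.

(* [m] stands for the code of the quotation of a program; the value is the code
   of the calculus running this program on input [m], see [self_input_code]. *)
Definition self_code (m : nat) : nat :=
  CodeSeq.code
    [:: CodeSeq.code sig;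
        CodeSeq.code
          (CodeSeq.code
             [:: form_code tZ;
                 CodeSeq.code
                   [:: 5; m;
                       CodeSeq.code
                         [:: 3; @form_code sig (quote (num m)); form_code tZ];
                       form_code tZ]]
           :: map (@rule_code sig) base_rules)].

Lemma computable_self_code : computable self_code.
Proof.
pose cZ := @form_code sig tZ.
have last : computable (fun=> CodeSeq.code [:: cZ]).
  exact: computable_const.
have data_code : computable (fun m =>
    CodeSeq.code [:: 3; @form_code sig (quote (num m)); cZ]).
  apply: (computable_code_cons (g := fun m => [:: _; _])).
    exact: computable_const.
  exact: (computable_code_cons computable_num_code).
have premise_code : computable (fun m =>
    CodeSeq.code [:: 5; m;
      CodeSeq.code [:: 3; @form_code sig (quote (num m)); cZ]; cZ]).
  apply: (computable_code_cons (g := fun m => [:: _; _; _])).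
    exact: computable_const.
  apply: (computable_code_cons (g := fun m => [:: _; _])).
    exact: computable_id.
  exact: (computable_code_cons data_code).
apply: (computable_code_cons (g := fun m => [:: _])).
  exact: computable_const.
apply: (computable_code_cons (g := fun=> [::])); last exact: computable_const.
(* Only the halting rule depends on [m]; the other rules contribute a constant. *)
apply: (computable_code_cons (g := fun=> _)); last exact: computable_const.
apply: (computable_code_cons (g := fun m => [:: _])).
  exact: computable_const.
apply: (computable_code_cons (g := fun=> [::])); last exact: computable_const.
exact: premise_code.
Qed.

(** * Diagonalization *)

Definition program_code (p : recfun 1) : nat := @form_code sig (quote (enc p)).

Definition self_input (p : recfun 1) : fin_calculus :=
  calculus (enc p) (vec [:: program_code p]).

Lemma halt_rule_code p v :
  @rule_code sig (halt_rule p v) =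
  CodeSeq.code [:: form_code tZ;
    CodeSeq.code [:: 5; form_code p; form_code v; form_code tZ]].
Proof. by rewrite -form_codeR. Qed.

Lemma self_input_code p :
  calculus_code (self_input p) = self_code (program_code p).
Proof. by rewrite /self_code -form_codeP -halt_rule_code. Qed.

Theorem theorem5p3 (K : frege_level) :
  ~ decidable_on
      (fun H => consistent (calculus_logic H))
      (fun H => in_level K (calculus_logic H)) /\
  ~ decidable_on
      (fun H => consistent (calculus_logic H) /\
                finitely_algebraizable (calculus_logic H))
      (fun H => in_level K (calculus_logic H)).
Proof.
(* A procedure for all consistent calculi also solves the restricted problem. *)
suff undec : ~ decidable_on
    (fun H => consistent (calculus_logic H) /\
              finitely_algebraizable (calculus_logic H))
    (fun H => in_level K (calculus_logic H)).
  by split=> // -[p dec]; apply: undec; exists p => H [/dec].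
move=> [p dec].
have [c cc] := computable_self_code.
(* Given the code of a program, [q] forms the code of the calculus running that program on this very
   code, and applies [p] to it. *)
pose q := Comp p (fun _ : 'I_1 => c); pose H := self_input q.
have qE y : computes p [tuple calculus_code H] y ->
    computes q [tuple program_code q] y.
  rewrite self_input_code => py; exists [tuple self_code (program_code q)].
  by split=> // i; rewrite (ord1 i); apply: cc.
have [yes no] := dec H (conj (calculus_consistent _ _)
  (calculus_finitely_algebraizable _ _)).
have runE : run (enc q) (vec [:: program_code q]) Z <->
    computes q [tuple program_code q] 0.
  split=> [/(@run_computes _ q [tuple program_code q]) [[|//] _ //]|].
  exact: (@computes_run _ q [tuple program_code q] 0).
(* If [H] is in the class, [q] outputs 1 and not 0, which expels [H]; if not, [q] outputs 0, which
   puts [H] in the class. *)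
have [/[dup] HK /yes /qE q1|HK] := pselect (in_level K (calculus_logic H)).
  move: HK; apply: nrun_calculus_notin_level => /runE q0.
  by have := computes_functional q0 q1.
by apply: (HK); apply: run_calculus_in_level; apply/runE/qE/no.
Qed.
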